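(* Let $f_1,\dots,f_\ell\in\mathbb{R}[x_1,\dots,x_n]$ be quadratic polynomials whose degree 2 homogeneous components $f_{j,2}$ are nonnegative (i.e. $f_{j,2}(x)\ge 0$ for all $x\in\mathbb{R}^n$ and all $j$). Define $\bar f:\mathbb{R}^n\to\mathbb{R}$ by $\bar f(x):=\max_{1\le j\le \ell} f_j(x)$ and let $c^*:=\min_{x\in\mathbb{R}^n}\bar f(x)$. Then there exist nonnegative weights $w_1,\dots,w_\ell\in\mathbb{R}$ such that $\sum_{j=1}^\ell w_j=1$ and $$\sum_{j=1}^\ell w_j f_j(x)\ge c^*\quad\text{for all } x\in\mathbb{R}^n.$$
   Context: The definition of $c^*$ presupposes that $\bar f$ attains its minimum on $\mathbb{R}^n$. *)

(* Defs.v *)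
From HB Require Import structures.
From mathcomp Require Import all_boot all_order all_algebra.
From mathcomp Require Import reals.
From mathcomp Require Import mpoly.

Set Implicit Arguments.
Unset Strict Implicit.
Unset Printing Implicit Defensive.

Import Order.TTheory GRing.Theory Num.Theory.
Local Open Scope ring_scope.

(* "Quadratic" means of total degree at most 2 (msize is the degree plus one,
   and 0 for the zero polynomial). *)
Definition quadratic (R : realType) (n : nat) (p : {mpoly R[n]}) : Prop :=
  (msize p <= 3)%N.

Definition hom2 (R : realType) (n : nat) (p : {mpoly R[n]}) : {mpoly R[n]} :=
  pihomog mdeg 2 p.

(* The family is indexed by 'I_l.+1, so it is nonempty; the default value
   (f ord0).@[x] of the iterated maximum is itself one of the values. *)
Definition fbar (R : realType) (n l : nat) (f : 'I_l.+1 -> {mpoly R[n]})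
    (x : 'I_n -> R) : R :=
  \big[Num.max/(f ord0).@[x]]_(j < l.+1) (f j).@[x].

Definition is_minimum (R : realType) (T : Type) (g : T -> R) (c : R) : Prop :=
  (exists x, g x = c) /\ (forall x, c <= g x).

(* Main.v *)
Require Import Defs.
From HB Require Import structures.
From mathcomp Require Import all_boot all_order all_algebra.
From mathcomp Require Import boolp classical_sets reals.
From mathcomp Require Import mpoly.
From mathcomp Require Import ring lra.

Import Order.TTheory GRing.Theory Num.Theory.
Local Open Scope ring_scope.

(** The hypothesis on the degree 2 components makes every [f j] convex: the
    convexity defect [t * p x + (1 - t) * p y - p (t x + (1 - t) y)] of a
    quadratic polynomial is [t * (1 - t)] times the value of its degree 2 part
    at [x - y] ([quadratic_convexity_defect]).  The theorem is then a theorem of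
    the alternative for convex functions: if the [f j - cstar] are never all
    negative at one point, some convex combination of them is nonnegative
    everywhere.

    The alternative ([convexlike_alternative]) is proved by induction on the
    number of functions, for families which are only convexlike in the sense of
    Ky Fan, on an arbitrary domain.  Where the first function [f0] is negative,
    the remaining ones are never all negative, so the induction hypothesis on
    the subdomain [f0 < 0] merges them into one combination [h].  Then [f0] and
    [h] are never both negative on the whole domain, which leaves the case of
    two functions ([convexlike_alternative2]).  There each point where one of
    the two is negative imposes a bound on the admissible weights; convexity
    along a segment shows that no lower bound exceeds an upper bound
    ([weight_bounds_compatible]), so the supremum of the lower bounds is an
    admissible weight. *)

(** * The alternative for convexlike families *)

(** Only the values of convex functions matter for the alternative, so segments
    are replaced by this condition of Ky Fan.  It needs no vector space and is
    inherited by sublevel sets [f j < 0]. *)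
Definition convexlike {R : realType} {T I : Type} (D : T -> Prop)
    (f : I -> T -> R) : Prop :=
  forall x y t, D x -> D y -> 0 <= t <= 1 ->
  exists2 z, D z & forall j, f j z <= t * f j x + (1 - t) * f j y.

(** Otherwise the determinant [g x * h y - h x * g y] would be negative, and
    some convex combination of the points [(g x, h x)] and [(g y, h y)] of the
    plane would have both coordinates negative.  Convexlikeness would turn it
    into a point of [D] where [g] and [h] are both negative. *)
Lemma weight_bounds_compatible {R : realType} {T : Type} {D : T -> Prop}
    {g h : T -> R} {x y : T} :
  convexlike D (fun b : bool => if b then g else h) ->
  (forall z, D z -> 0 <= g z \/ 0 <= h z) ->
  D x -> D y -> h x < 0 -> g y < 0 ->
  - h x / (g x - h x) <= h y / (h y - g y).
Proof.
move=> cvx alt Dx Dy hx0 gy0.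
have gx0 : 0 <= g x by case: (alt x Dx) => //; lra.
have hy0 : 0 <= h y by case: (alt y Dy) => //; lra.
suff det : h x * g y <= h y * g x.
  rewrite ler_pdivrMr; last by lra.
  rewrite mulrAC ler_pdivlMr; lra.
rewrite leNgt; apply/negP => det.
(* Weighting the two points by [u] and [v] makes either coordinate of the
   combination equal to the determinant, up to the positive factor [u + v]. *)
pose u := h y - g y; pose v := g x - h x.
have uv : 0 < u + v by rewrite /u /v; lra.
have t01 : 0 <= u / (u + v) <= 1.
  by rewrite divr_ge0 ?ler_pdivrMr ?mul1r /u /v //; lra.
have [z Dz fz] := cvx x y _ Dx Dy t01.
have tc : 1 - u / (u + v) = v / (u + v) by field; rewrite gt_eqF.
have neg a b : u * a + v * b < 0 ->
    u / (u + v) * a + (1 - u / (u + v)) * b < 0.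
  move=> ab; rewrite tc.
  have -> : u / (u + v) * a + v / (u + v) * b = (u * a + v * b) / (u + v).
    by field; rewrite gt_eqF.
  by rewrite pmulr_llt0 ?invr_gt0.
have gz : g z < 0 by apply: le_lt_trans (fz true) _; apply: neg; rewrite /u /v; lra.
have hz : h z < 0 by apply: le_lt_trans (fz false) _; apply: neg; rewrite /u /v; lra.
by case: (alt z Dz); rewrite leNgt ?gz ?hz.
Qed.

(** At a point [x] the weight [s] is a zero of [s * g x + (1 - s) * h x] for
    [s = - h x / (g x - h x)].  This is a lower bound on the admissible weights
    when [h x < 0], an upper bound when [g x < 0], and [s] is unconstrained by
    [x] when both values are nonnegative. *)
Lemma convexlike_alternative2 {R : realType} {T : Type} {D : T -> Prop}
    {g h : T -> R} :
  convexlike D (fun b : bool => if b then g else h) ->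
  (forall x, D x -> 0 <= g x \/ 0 <= h x) ->
  exists2 s, 0 <= s <= 1 & forall x, D x -> 0 <= s * g x + (1 - s) * h x.
Proof.
move=> cvx alt.
have [[x0 [Dx0 hx0]]|nh] := pselect (exists x, D x /\ h x < 0); last first.
  exists 0 => [|x Dx]; first by lra.
  have [hx|] := ltP (h x) 0; last by lra.
  by case: nh; exists x.
pose L : set R := fun s => exists x, [/\ D x, h x < 0 & s = - h x / (g x - h x)].
have g_ge0 x : D x -> h x < 0 -> 0 <= g x.
  by move=> Dx hx; case: (alt x Dx) => //; lra.
have L01 s : L s -> 0 <= s <= 1.
  case=> x [Dx hx ->]; have gx := g_ge0 x Dx hx.
  by rewrite divr_ge0 ?ler_pdivrMr ?mul1r //; lra.
have L0 : L (- h x0 / (g x0 - h x0)) by exists x0.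
have Lne : nonempty L by exists (- h x0 / (g x0 - h x0)).
have Lub : has_ubound L by exists 1 => s /L01 /andP[].
have sup01 : 0 <= sup L <= 1.
  apply/andP; split; last by apply: ge_sup => // s /L01 /andP[].
  by apply: le_trans (ub_le_sup Lub L0); case/andP: (L01 _ L0).
exists (sup L) => // x Dx.
have [hx|hx] := ltP (h x) 0.
  have gx := g_ge0 x Dx hx.
  have : - h x / (g x - h x) <= sup L by apply: ub_le_sup => //; exists x.
  by rewrite ler_pdivrMr; lra.
have [gx|gx] := ltP (g x) 0.
  have : sup L <= h x / (h x - g x).
    apply: ge_sup => // s [y [Dy hy ->]].
    exact: weight_bounds_compatible cvx alt Dy Dx hy gx.
  by rewrite ler_pdivlMr; lra.
by case/andP: sup01 => s0 s1; rewrite addr_ge0 ?mulr_ge0 // subr_ge0.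
Qed.

Lemma convexlike_alternative {R : realType} {T : Type} {l : nat}
    {D : T -> Prop} (f : 'I_l.+1 -> T -> R) :
  convexlike D f ->
  (forall x, D x -> exists j, 0 <= f j x) ->
  exists w : 'I_l.+1 -> R,
    [/\ forall j, 0 <= w j, \sum_j w j = 1
      & forall x, D x -> 0 <= \sum_j w j * f j x].
Proof.
elim: l D f => [|l IH] D f cvx alt.
  exists (fun=> 1); split=> [j||x Dx]; first exact: ler01.
    by rewrite big_ord1.
  by rewrite big_ord1 mul1r; have [j] := alt x Dx; rewrite (ord1 j).
pose D' x := D x /\ f ord0 x < 0.
have [|x [Dx f0x]|w [w0 w1 wf]] := IH D' (fun k => f (lift ord0 k)).
- move=> x y t [Dx fx] [Dy fy] t01; have [z Dz fz] := cvx x y t Dx Dy t01.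
  exists z => [|k //]; split=> //; apply: le_lt_trans (fz ord0) _.
  by case/andP: t01 => ? ?; nra.
- have [j fj] := alt x Dx; case: (unliftP ord0 j) => [k|] Ej.
    by exists k; rewrite -Ej.
  by move: fj; rewrite Ej leNgt f0x.
pose h x := \sum_k w k * f (lift ord0 k) x.
have [||s s01 sP] := convexlike_alternative2 (D := D) (g := f ord0) (h := h).
- move=> x y t Dx Dy t01; have [z Dz fz] := cvx x y t Dx Dy t01.
  exists z => // -[]; first exact: fz.
  rewrite /h !mulr_sumr -big_split /=; apply: ler_sum => k _.
  rewrite 2![_ * (w k * _)]mulrCA -mulrDr; exact: ler_wpM2l.
- move=> x Dx; have [f0x|] := ltP (f ord0 x) 0; last by left.
  by right; apply: wf.
exists (fun j => if unlift ord0 j is Some k then (1 - s) * w k else s).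
have [s0 s1] := andP s01.
split=> [j||x Dx].
- by case: unliftP => [k|] _ //; rewrite mulr_ge0 // subr_ge0.
- rewrite big_ord_recl unlift_none.
  under eq_bigr => k _ do rewrite liftK.
  by rewrite -mulr_sumr w1; ring.
- rewrite big_ord_recl unlift_none.
  under eq_bigr => k _ do rewrite liftK -mulrA.
  by rewrite -mulr_sumr; apply: sP.
Qed.

(** * Convexity of quadratic polynomials *)

Lemma mdeg_succP {n d : nat} {m : 'X_{1.. n}} :
  mdeg m = d.+1 -> exists i m', m = (U_(i) + m')%MM /\ mdeg m' = d.
Proof.
move=> dm; have [i mi] : exists i, m i != 0%N.
  by apply/existsP; rewrite -negb_forall; apply/negP => /forallP m0;
     move: dm; rewrite mdegE big1 // => i _; apply/eqP.
have Em : m = (U_(i) + (m - U_(i)))%MM.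
  by rewrite addmC submK // lep1mP.
exists i, (m - U_(i))%MM; split=> //.
by move: dm; rewrite {1}Em mdegD mdeg1 add1n => -[].
Qed.

(** Both sides are linear in [p], so it is enough to compare them on the
    monomials [1], ['X_i] and ['X_i * 'X_j]. *)
Lemma quadratic_convexity_defect {R : realType} {n : nat} {p : {mpoly R[n]}}
    (x y : 'I_n -> R) (t : R) :
  quadratic p ->
  t * p.@[x] + (1 - t) * p.@[y] - p.@[fun i => t * x i + (1 - t) * y i]
  = t * (1 - t) * (hom2 p).@[fun i => x i - y i].
Proof.
move=> pq.
have evalE v : p.@[v] = \sum_(m <- msupp p) p@_m * ('X_[m] : {mpoly R[n]}).@[v].
  rewrite {1}(mpolyE p) (raddf_sum (meval v)).
  by apply: eq_bigr => m _; exact: mevalZ.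
rewrite /hom2 pihomogE (raddf_sum (meval _)) big_mkcond !evalE !mulr_sumr.
rewrite -big_split -sumrB; apply: eq_big_seq => m mp; rewrite /= mevalZ.
have : (mdeg m < 3)%N by apply: leq_trans (msize_mdeg_lt mp) pq.
case dm: (mdeg m) => [|[|[|//]]] _ /=.
- have -> : m = 0%MM by apply/eqP; rewrite -mdeg_eq0 dm.
  by rewrite mpolyX0 !meval1; ring.
- have [i [m' [-> /eqP]]] := mdeg_succP dm.
  rewrite mdeg_eq0 => /eqP ->.
  by rewrite addm0 !mevalXU; ring.
- have [i [m1 [-> /mdeg_succP[j [m' [-> /eqP]]]]]] := mdeg_succP dm.
  rewrite mdeg_eq0 => /eqP ->.
  by rewrite addm0 !mpolyXD !mevalM !mevalXU; ring.
Qed.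

Lemma quadratic_convex {R : realType} {n : nat} {p : {mpoly R[n]}}
    (x y : 'I_n -> R) (t : R) :
  quadratic p -> (forall v, 0 <= (hom2 p).@[v]) -> 0 <= t <= 1 ->
  p.@[fun i => t * x i + (1 - t) * y i] <= t * p.@[x] + (1 - t) * p.@[y].
Proof.
move=> pq p2 /andP[t0 t1]; rewrite -subr_ge0 quadratic_convexity_defect //.
by rewrite mulr_ge0 ?mulr_ge0 ?subr_ge0.
Qed.

(** * Weights for the maximum of the family *)

Theorem theorem18 (R : realType) (n l : nat) (f : 'I_l.+1 -> {mpoly R[n]})
    (hquad : forall j : 'I_l.+1, quadratic (f j))
    (hnonneg : forall (j : 'I_l.+1) (x : 'I_n -> R), 0 <= (hom2 (f j)).@[x])
    (cstar : R) (hcstar : is_minimum (fbar f) cstar) :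
  exists w : 'I_l.+1 -> R,
    [/\ forall j : 'I_l.+1, 0 <= w j,
        \sum_(j < l.+1) w j = 1
      & forall x : 'I_n -> R, cstar <= \sum_(j < l.+1) w j * (f j).@[x] ].
Proof.
have [_ cle] := hcstar.
have [||w [w0 w1 wf]] := convexlike_alternative (D := fun=> True)
    (fun j (x : 'I_n -> R) => (f j).@[x] - cstar).
- move=> x y t _ _ t01; exists (fun i => t * x i + (1 - t) * y i) => // j.
  have := quadratic_convex x y t (hquad j) (hnonneg j) t01; lra.
- move=> x _; apply: contrapT => nf.
  have flt j : (f j).@[x] < cstar.
    by rewrite ltNge; apply/negP => fj; apply: nf; exists j; rewrite subr_ge0.
  by have := cle x; rewrite leNgt /fbar bigmax_lt.
exists w; split=> // x; have := wf x I.
under eq_bigr => j _ do rewrite mulrBr.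
by rewrite sumrB -mulr_suml w1 mul1r subr_ge0.
Qed.
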